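(* Let $\mathsf{f}\in\mathbb{R}^n$, let $\mathsf{p}\in\mathbb{R}^n$ be a probability vector with $p_i>0$ for all $i$, and let $\alpha\in[0,1)$. For $\varepsilon\in[0,1]$ let $$\mathcal{Q}_{\rm c}(\varepsilon)=(1-\varepsilon)\{\mathsf{p}\}+\varepsilon\Big\{\mathsf{q}\in\mathbb{R}^n\ \Big|\ \sum_{i=1}^nq_i=1,\ 0\le q_i\le\tfrac{1}{1-\alpha}p_i\ (i=1,\dots,n)\Big\},\qquad V_{\rm c}(\varepsilon;\mathsf{f})=\max_{\mathsf{q}\in\mathcal{Q}_{\rm c}(\varepsilon)}\sum_{i=1}^nq_if_i .$$ Then, for every $\varepsilon\in[0,1]$: (i) if $k$ is such that $\sum_{i=1}^kp_{(i)}\le1-\alpha<\sum_{i=1}^{k+1}p_{(i)}$, a maximizer (worst-case probability distribution) is given by $$q_{(i)}=\Big(1+\frac{\alpha\varepsilon}{1-\alpha}\Big)p_{(i)}\ (i=1,\dots,k),\qquad q_{(k+1)}=(1-\varepsilon)p_{(k+1)}+\varepsilon\Big(1-\frac{1}{1-\alpha}\sum_{i=1}^kp_{(i)}\Big),\qquad q_{(i)}=(1-\varepsilon)p_{(i)}\ (i=k+2,\dots,n);$$ (ii) the worst-case expected cost is $$V_{\rm c}(\varepsilon;\mathsf{f})=(1-\varepsilon)\mathbb{E}_{\mathsf{p}}(\mathsf{f})+\varepsilon\,\mathrm{CVaR}_{\mathsf{p},\alpha}(\mathsf{f})=\mathbb{E}_{\mathsf{p}}(\mathsf{f})+\varepsilon\big(\mathrm{CVaR}_{\mathsf{p},\alpha}(\mathsf{f})-\mathbb{E}_{\mathsf{p}}(\mathsf{f})\big).$$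 Accordingly, $$\lim_{\varepsilon\downarrow0}\frac{V_{\rm c}(\varepsilon;\mathsf{f})-V_{\rm c}(0;\mathsf{f})}{\varepsilon}=\mathrm{CVaR}_{\mathsf{p},\alpha}(\mathsf{f})-\mathbb{E}_{\mathsf{p}}(\mathsf{f}).$$
   Context: The components of $\mathsf{f}$ are ordered from largest to smallest, $f_{(1)}\ge\cdots\ge f_{(n)}$ (ties broken by a fixed ordering); $p_{(i)}$ and $q_{(i)}$ denote the masses that $\mathsf{p}$ and $\mathsf{q}$ put on the index corresponding to $f_{(i)}$; $k\in\{0,\dots,n-1\}$ and empty sums are $0$. $\mathbb{E}_{\mathsf{p}}(\mathsf{f})=\sum_ip_if_i$. For $\alpha\in[0,1)$ the conditional value-at-risk is $$\mathrm{CVaR}_{\mathsf{p},\alpha}(\mathsf{f})=\min_{\gamma\in\mathbb{R}}\Big\{\gamma+\frac{1}{1-\alpha}\sum_{i=1}^np_i\max\{f_i-\gamma,0\}\Big\}.$$ *)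

(* Defs.v *)
From HB Require Import structures.
From mathcomp Require Import all_boot all_order all_algebra all_fingroup.
From mathcomp Require Import all_classical all_reals all_analysis.
Set Implicit Arguments.
Unset Strict Implicit.
Unset Printing Implicit Defensive.
Import Order.TTheory GRing.Theory Num.Theory.
Import numFieldNormedType.Exports.
Local Open Scope classical_set_scope.
Local Open Scope ring_scope.

Definition is_maximizer (R : realType) (T : Type) (A : set T) (F : T -> R)
    (x : T) : Prop :=
  A x /\ forall y, A y -> F y <= F x.

Definition is_minimizer (R : realType) (T : Type) (A : set T) (F : T -> R)
    (x : T) : Prop :=
  A x /\ forall y, A y -> F x <= F y.

Definition expect (R : realType) (n : nat) (q f : 'rV[R]_n) : R :=
  \sum_(i < n) q 0 i * f 0 i.

Definition cvar_objective (R : realType) (n : nat) (p : 'rV[R]_n) (alpha : R)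
    (f : 'rV[R]_n) (gamma : R) : R :=
  gamma + (1 - alpha)^-1 * \sum_(i < n) p 0 i * Num.max (f 0 i - gamma) 0.

(* [inf] is a junk value when the set is empty or unbounded below; that it is
   an attained minimum has to be proved separately. *)
Definition CVaR (R : realType) (n : nat) (p : 'rV[R]_n) (alpha : R)
    (f : 'rV[R]_n) : R :=
  inf [set cvar_objective p alpha f gamma | gamma in [set: R]].

Definition cvar_envelope (R : realType) (n : nat) (p : 'rV[R]_n) (alpha : R) :
    set 'rV[R]_n :=
  [set q | \sum_(i < n) q 0 i = 1 /\
           forall i, 0 <= q 0 i <= (1 - alpha)^-1 * p 0 i].

(* Minkowski combination (1 - eps) {p} + eps (cvar_envelope p alpha). *)
Definition Qc (R : realType) (n : nat) (p : 'rV[R]_n) (alpha eps : R) :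
    set 'rV[R]_n :=
  [set (1 - eps) *: u + eps *: v | u in [set p] & v in cvar_envelope p alpha].

(* As for [CVaR], attainment of the supremum has to be proved separately. *)
Definition Vc (R : realType) (n : nat) (p : 'rV[R]_n) (alpha eps : R)
    (f : 'rV[R]_n) : R :=
  sup [set expect q f | q in Qc p alpha eps].

(* [s i] is the index carrying the [i]-th largest component of [f], counting
   from [0]; every tie-breaking rule is one such [s]. *)
Definition sorts_decreasingly (R : realType) (n : nat) (f : 'rV[R]_n)
    (s : 'S_n) : Prop :=
  forall i j : 'I_n, (i <= j)%N -> f 0 (s j) <= f 0 (s i).

(* Main.v *)
(* Sorting f decreasingly and filling up mass from the top, with the cap
   p_i / (1 - alpha), gives a distribution that attains the weak-duality bound
   E_q(f) <= gamma + (1 - alpha)^-1 E_p(max(f - gamma, 0)) at gamma = f_(k+1).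
   So it maximizes E_q(f) over the envelope, gamma minimizes the CVaR objective,
   and the two optimal values agree; the rest is linearity in eps. *)
Require Import Defs.
From HB Require Import structures.
From mathcomp Require Import all_boot all_order all_algebra all_fingroup.
From mathcomp Require Import all_classical all_reals all_analysis.
From mathcomp Require Import ring.
Import Order.TTheory GRing.Theory Num.Theory.
Import numFieldNormedType.Exports.
Local Open Scope classical_set_scope.
Local Open Scope ring_scope.

Set Implicit Arguments.
Unset Strict Implicit.

(** A maximizer makes the image nonempty and bounded above, so [sup] is a genuine supremum here and
    not its default value; [inf_minimizer] is the mirror image. *)
Lemma sup_maximizer (R : realType) (T : Type) (A : set T) (F : T -> R) (x : T) :
  is_maximizer A F x -> sup [set F y | y in A] = F x.
Proof.
move=> [Ax Fx]; apply/eqP; rewrite eq_le; apply/andP; split.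
  by apply: ge_sup => [|_ [y Ay <-]]; [exists (F x), x|exact: Fx].
by apply: ub_le_sup; [exists (F x) => _ [y Ay <-]; exact: Fx|exists x].
Qed.

Lemma inf_minimizer (R : realType) (T : Type) (A : set T) (F : T -> R) (x : T) :
  is_minimizer A F x -> inf [set F y | y in A] = F x.
Proof.
move=> [Ax Fx]; apply/eqP; rewrite eq_le; apply/andP; split.
  by apply: ge_inf; [exists (F x) => _ [y Ay <-]; exact: Fx|exists x].
by apply: lb_le_inf => [|_ [y Ay <-]]; [exists (F x), x|exact: Fx].
Qed.

Lemma sorts_decreasingly_exists (R : realType) (n : nat) (f : 'rV[R]_n) :
  exists s : 'S_n, sorts_decreasingly f s.
Proof.
pose r : rel 'I_n := fun i j => f 0 j <= f 0 i.
have r_tot : total r by move=> i j; exact: le_total.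
have r_tr : transitive r by move=> j i l ji lj; exact: le_trans lj ji.
pose t := sort_tuple r (ord_tuple n).
have t_inj : injective (tnth t).
  by apply/tuple_uniqP; rewrite /= sort_uniq enum_uniq.
exists (perm t_inj) => i j ij; rewrite !permE !(tnth_nth i).
apply: (sorted_leq_nth r_tr) => //; rewrite ?inE ?size_tuple ?ltn_ord //.
- by move=> x; exact: lexx.
- by rewrite /=; exact: sort_sorted.
Qed.

(** Take the least [k] whose inclusive partial sum reaches [b]. Both bounds are weak so that [b] may
    equal the total mass, which happens for [alpha = 0]; no index would then satisfy a strict upper
    bound. *)
Lemma quantile_index_exists (R : realType) (n : nat) (w : 'I_n -> R) (b : R) :
    0 <= b -> b <= \sum_(i < n) w i -> (0 < n)%N ->
  exists k : 'I_n, \sum_(i < n | (i < k)%N) w i <= b /\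
                   b <= \sum_(i < n | (i <= k)%N) w i.
Proof.
case: n w => [//|n] w b0 bw _.
pose P (k : 'I_n.+1) := b <= \sum_(i < n.+1 | (i <= k)%N) w i.
have Pmax : P ord_max.
  by rewrite /P (eq_bigl xpredT) // => i; rewrite -ltnS ltn_ord.
case: (arg_minnP (fun k : 'I_n.+1 => nat_of_ord k) Pmax) => k Pk kmin.
exists k; split=> //; case: k Pk kmin => -[|k] kn Pk kmin /=.
  by rewrite big_pred0.
have kn' : (k < n.+1)%N by exact: ltnW.
(* Here [k] is the predecessor: if the head sum exceeded [b], the predecessor would satisfy [P],
   against minimality. *)
rewrite leNgt; apply/negP => lt_b.
by have /(_ (ltW lt_b)) := kmin (Ordinal kn'); rewrite /= ltnn.
Qed.

Lemma expect_combination (R : realType) (n : nat) (a b : R) (u v f : 'rV[R]_n) :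
  expect (a *: u + b *: v) f = a * expect u f + b * expect v f.
Proof.
rewrite /expect !mulr_sumr -big_split; apply: eq_bigr => i _ /=.
by rewrite !mxE mulrDl !mulrA.
Qed.

Lemma expect_center (R : realType) (n : nat) (q f : 'rV[R]_n) (gamma : R) :
  \sum_(i < n) q 0 i = 1 ->
  expect q f = gamma + \sum_(i < n) q 0 i * (f 0 i - gamma).
Proof.
move=> q1; under eq_bigr do rewrite mulrBr.
by rewrite sumrB -mulr_suml q1 mul1r addrC subrK.
Qed.

(** Since [q] has mass 1, [gamma] can be subtracted from [f]. Termwise, [q 0 i >= 0] allows passing
    to the positive part, and the cap on [q 0 i] then bounds the term. *)
Lemma expect_le_cvar_objective (R : realType) (n : nat) (p f q : 'rV[R]_n)
    (alpha gamma : R) :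
  cvar_envelope p alpha q -> expect q f <= cvar_objective p alpha f gamma.
Proof.
move=> [q1 qp]; rewrite (expect_center f gamma q1) lerD2l mulr_sumr.
apply: ler_sum => i _; have /andP[q0 qle] := qp i; rewrite mulrA.
apply: (@le_trans _ _ (q 0 i * Num.max (f 0 i - gamma) 0)).
  by rewrite ler_wpM2l // le_max lexx.
by rewrite ler_wpM2r // le_max lexx orbT.
Qed.

Section Greedy.
Variables (R : realType) (n : nat) (f p : 'rV[R]_n) (alpha : R).
Variables (s : 'S_n) (k : 'I_n).
Hypothesis p_gt0 : forall i, 0 < p 0 i.
Hypothesis alpha_lt1 : alpha < 1.
Hypothesis s_sorts : sorts_decreasingly f s.
Hypothesis head_le : \sum_(i < n | (i < k)%N) p 0 (s i) <= 1 - alpha.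
Hypothesis head_ge : 1 - alpha <= \sum_(i < n | (i <= k)%N) p 0 (s i).

Let greedy_weight (i : 'I_n) : R :=
  if (i < k)%N then (1 - alpha)^-1 * p 0 (s i) else
  if i == k then 1 - (1 - alpha)^-1 * \sum_(j < n | (j < k)%N) p 0 (s j)
  else 0.

Definition greedy : 'rV[R]_n := \row_i greedy_weight ((s^-1)%g i).

Lemma greedyE i : greedy 0 (s i) =
  if (i < k)%N then (1 - alpha)^-1 * p 0 (s i) else
  if i == k then 1 - (1 - alpha)^-1 * \sum_(j < n | (j < k)%N) p 0 (s j)
  else 0.
Proof. by rewrite mxE permK. Qed.

Lemma greedy_envelope : cvar_envelope p alpha greedy.
Proof.
have a0 : 0 < 1 - alpha by rewrite subr_gt0.
have c0 : 0 <= (1 - alpha)^-1 by rewrite invr_ge0 ltW.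
split.
  (* Summing by rank, the ranks below [k] cancel against the residual mass at rank [k], leaving
     1. *)
  rewrite (reindex_inj (@perm_inj _ s)) /=.
  rewrite (bigID (fun i : 'I_n => (i < k)%N)) /= [X in _ + X](bigD1 k) ?ltnn //=.
  rewrite [X in _ + (_ + X)]big1 => [|i /andP[/negbTE ik /negbTE nk]]; last first.
    by rewrite greedyE ik nk.
  under eq_bigr => i ik do rewrite greedyE ik.
  by rewrite greedyE ltnn eqxx -mulr_sumr addr0 addrC subrK.
move=> i; rewrite -[i](permKV s) greedyE; set j := (s^-1)%g i.
have pj : 0 <= (1 - alpha)^-1 * p 0 (s j) by rewrite mulr_ge0 // ltW.
case: ifP => [_|_]; first by rewrite pj lexx.
case: eqP => [->|_]; last by rewrite lexx pj.
(* For the residual mass at rank [k], [head_le] gives nonnegativity and [head_ge] the cap, once the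
   term of rank [k] is split off its sum. *)
rewrite subr_ge0 lerBlDr -mulrDr ler_pdivrMl // mulr1 head_le.
rewrite ler_pdivlMl // mulr1 (le_trans head_ge) //.
rewrite (bigD1 k) //= lerD2l le_eqVlt; apply/orP; left; apply/eqP.
by apply: eq_bigl => l; rewrite ltn_neqAle andbC.
Qed.

(* Complementary slackness: [greedy] is saturated where [f] exceeds its value
   at [s k] and vanishes where [f] is below it. *)
Lemma expect_greedy : expect greedy f = cvar_objective p alpha f (f 0 (s k)).
Proof.
rewrite (expect_center f (f 0 (s k)) greedy_envelope.1) /cvar_objective.
congr (_ + _); rewrite mulr_sumr.
rewrite [LHS](reindex_inj (@perm_inj _ s)) [RHS](reindex_inj (@perm_inj _ s)) /=.
apply: eq_bigr => i _; rewrite greedyE mulrA.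
case: ltngtP => [ik|ki|/val_inj ->].
- by rewrite max_l // subr_ge0 s_sorts // ltnW.
- case: eqP ki => [->|_ ki]; first by rewrite ltnn.
  by rewrite mul0r max_r ?mulr0 // subr_le0 s_sorts // ltnW.
(* At rank [k] both sides vanish, whatever the residual mass. *)
- by rewrite subrr maxxx !mulr0.
Qed.

Lemma greedy_maximizer :
  is_maximizer (cvar_envelope p alpha) (fun q => expect q f) greedy.
Proof.
split; first exact: greedy_envelope.
by move=> q qE; rewrite expect_greedy; exact: expect_le_cvar_objective.
Qed.

(** The feasible point [greedy] certifies optimality: its expectation bounds the objective from
    below at every [gamma] and is attained at [f 0 (s k)]. *)
Lemma cvar_objective_minimizer :
  is_minimizer [set: R] (cvar_objective p alpha f) (f 0 (s k)).
Proof.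
split=> // gamma _; rewrite -expect_greedy.
exact/expect_le_cvar_objective/greedy_envelope.
Qed.

Lemma CVaR_greedy : CVaR p alpha f = expect greedy f.
Proof. by rewrite expect_greedy; exact/inf_minimizer/cvar_objective_minimizer. Qed.

(** The share of [p] is fixed, so only the envelope component varies, with weight [eps >= 0]. *)
Lemma Qc_maximizer (eps : R) : 0 <= eps ->
  is_maximizer (Qc p alpha eps) (fun q => expect q f)
    ((1 - eps) *: p + eps *: greedy).
Proof.
move=> eps0; split.
  by exists p => //; exists greedy => //; exact: greedy_envelope.
move=> _ [_ -> [v vE <-]]; rewrite !expect_combination lerD2l ler_wpM2l //.
exact: greedy_maximizer.2.
Qed.

Lemma Vc_greedy (eps : R) : 0 <= eps ->
  Vc p alpha eps f = (1 - eps) * expect p f + eps * CVaR p alpha f.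
Proof.
move=> eps0.
by rewrite /Vc (sup_maximizer (Qc_maximizer eps0)) expect_combination CVaR_greedy.
Qed.

End Greedy.

Unset Implicit Arguments.
Set Strict Implicit.

Theorem proposition4p6 (R : realType) (n : nat) (f p : 'rV[R]_n) (alpha : R)
    (p_gt0 : forall i, 0 < p 0 i) (p_sum1 : \sum_(i < n) p 0 i = 1)
    (alpha01 : 0 <= alpha < 1) :
  (exists gamma, is_minimizer [set: R] (cvar_objective p alpha f) gamma /\
                 cvar_objective p alpha f gamma = CVaR p alpha f) /\
  (forall eps : R, 0 <= eps <= 1 ->
    [/\ (exists q, is_maximizer (Qc p alpha eps) (fun q => expect q f) q /\
                   expect q f = Vc p alpha eps f),
        (forall (s : 'S_n) (k : 'I_n), sorts_decreasingly f s ->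
          \sum_(i < n | (i < k)%N) p 0 (s i) <= 1 - alpha ->
          1 - alpha < \sum_(i < n | (i <= k)%N) p 0 (s i) ->
          exists q : 'rV[R]_n,
            [/\ (forall i : 'I_n, (i < k)%N ->
                   q 0 (s i) = (1 + alpha * eps / (1 - alpha)) * p 0 (s i)),
                q 0 (s k) = (1 - eps) * p 0 (s k) +
                  eps * (1 - (1 - alpha)^-1 *
                             \sum_(i < n | (i < k)%N) p 0 (s i)),
                (forall i : 'I_n, (k < i)%N ->
                   q 0 (s i) = (1 - eps) * p 0 (s i)) &
                is_maximizer (Qc p alpha eps) (fun q => expect q f) q]),
        Vc p alpha eps f =
          (1 - eps) * expect p f + eps * CVaR p alpha f &
        Vc p alpha eps f =
          expect p f + eps * (CVaR p alpha f - expect p f)]) /\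
  (Vc p alpha eps f - Vc p alpha 0 f) / eps @[eps --> (0 : R)^'+]
    --> CVaR p alpha f - expect p f.
Proof.
have [alpha0 alpha1] := andP alpha01.
have a0 : 0 < 1 - alpha by rewrite subr_gt0.
have n0 : (0 < n)%N.
  case: n f p p_gt0 p_sum1 => [|//] f' p' _ /eqP.
  by rewrite big_ord0 eq_sym oner_eq0.
have [s s_sorts] := sorts_decreasingly_exists f.
have [|k [head_le head_ge]] :=
  quantile_index_exists (w := fun i => p 0 (s i)) (ltW a0) _ n0.
  by move: p_sum1; rewrite (reindex_inj (@perm_inj _ s)) /= => ->; rewrite gerBl.
have VcE (eps : R) : 0 <= eps ->
    Vc p alpha eps f = (1 - eps) * expect p f + eps * CVaR p alpha f.
  exact: (Vc_greedy p_gt0 alpha1 s_sorts head_le head_ge).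
split; [|split].
- have min := cvar_objective_minimizer p_gt0 alpha1 s_sorts head_le head_ge.
  by exists (f 0 (s k)); split; rewrite // /CVaR (inf_minimizer min).
- move=> eps /andP[eps0 _]; split.
  + have max := Qc_maximizer p_gt0 alpha1 s_sorts head_le head_ge eps0.
    by exists ((1 - eps) *: p + eps *: greedy p alpha s k); split;
      rewrite // /Vc (sup_maximizer max).
  (* The given [s'] may break ties differently from the [s] chosen above, so the greedy point is
     rebuilt from [s'] and [k']. *)
  + move=> s' k' s'_sorts head_le' /ltW head_ge'.
    exists ((1 - eps) *: p + eps *: greedy p alpha s' k').
    split; last exact: Qc_maximizer.
    (* The two shares add up by [1 - eps + eps / (1 - alpha) = 1 + alpha * eps / (1 - alpha)]. *)
    * move=> i ik; rewrite 2!mxE [X in _ + X]mxE greedyE ik.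
      by field; rewrite gt_eqF.
    * by rewrite 2!mxE [X in _ + X]mxE greedyE ltnn eqxx.
    * move=> i ki; rewrite 2!mxE [X in _ + X]mxE greedyE ltnNge (ltnW ki) /=.
      by rewrite -val_eqE gtn_eqF // mulr0 addr0.
  + exact: VcE.
  + by rewrite VcE //; ring.
(* [Vc] is affine in [eps >= 0], so the difference quotient equals its limit at every [eps > 0]. *)
- apply: cvg_near_cst; near=> eps.
  have eps0 : 0 < eps by near: eps; exact: nbhs_right_gt.
  rewrite !VcE // ?ltW //.
  by field; rewrite gt_eqF.
Unshelve. all: by end_near.
Qed.
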